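(* Let $R$ be an integral domain and let $\ast=\tilde{\ast}$ be a star operation on $R$ that is spectral and of finite type. If $R$ is Clifford $\ast$-regular, then $\ast=w$, the $w$-operation on $R$.
   Context: $R$ is an integral domain with field of fractions $K$. An ideal of $R$ means a nonzero fractional ideal (an integral ideal if contained in $R$); prime ideals are integral and nonzero. $\mathcal F(R)$ is the set of ideals, and $(J:I)=\{x\in K: xI\subseteq J\}$. A star operation on $R$ is a map $\mathcal F(R)\to\mathcal F(R)$, $I\mapsto I^\ast$, such that for all $0\ne a\in K$ and $I,J\in\mathcal F(R)$: $R^\ast=R$ and $(aI)^\ast=aI^\ast$; $I\subseteq I^\ast$, and $I\subseteq J$ implies $I^\ast\subseteq J^\ast$; $I^{\ast\ast}=I^\ast$. It is of finite type if $I^\ast=\bigcup\{J^\ast: J\subseteq I,\ J \text{ a finitely generated ideal}\}$ for all $I$. $I$ is a $\ast$-ideal if $I=I^\ast$; a $\ast$-maximal ideal is a maximal element of the set of proper integral $\ast$-ideals; $\ast\text{-Max}(R)$ is the set of $\ast$-maximal ideals. For $\ast$ of finite type, $\tilde{\ast}$ is the star operation $I\mapsto\bigcap_{M\in\ast\text{-Max}(R)}IR_M$; one has $\ast=\tilde\ast$ exactly when $\ast$ is spectral (i.e. $I^\ast=\bigcap_{P\in\mathcal G}IR_P$ for some family $\mathcal G$ of pairwise incomparable primes with $R=\bigcap_{P\in\mathcal G}R_P$) and of finite type. $I^v=(R:(R:I))$, $I^t=\bigcup\{J^v: J\subseteq I \text{ a finitely generated ideal}\}$, and $w=\tilde t$.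 $R$ is Clifford $\ast$-regular if for every ideal $I$ of $R$ there is an ideal $J$ of $R$ with $I^\ast=(I^2J)^\ast$ (equivalently, the semigroup of $\ast$-ideals under $(I,J)\mapsto (IJ)^\ast$ modulo principal ideals is a Clifford semigroup). *)

(* Defs.v *)
From mathcomp Require Import all_boot all_order all_algebra.
From mathcomp Require Import boolp classical_sets.

Set Implicit Arguments.
Unset Strict Implicit.
Unset Printing Implicit Defensive.

Import GRing.Theory.

Local Open Scope classical_set_scope.
Local Open Scope ring_scope.

(* Ideals are subsets of the field of fractions {fraction R}; the domain R is
   identified with its image under the embedding tofrac. *)

Definition domset (R : idomainType) : set {fraction R} := range (@tofrac R).
Arguments domset R : clear implicits.

Definition is_submod (R : idomainType) (I : set {fraction R}) : Prop :=
  [/\ I 0,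
      forall x y, I x -> I y -> I (x + y) &
      forall (r : R) x, I x -> I (tofrac r * x)].

(* Nonzero fractional ideals. *)
Definition is_ideal (R : idomainType) (I : set {fraction R}) : Prop :=
  [/\ is_submod I,
      exists x, I x /\ x != 0 &
      exists d : R, d != 0 /\ forall x, I x -> domset R (tofrac d * x)].

Definition is_integral (R : idomainType) (I : set {fraction R}) : Prop :=
  is_ideal I /\ I `<=` domset R.

Definition is_prime (R : idomainType) (P : set {fraction R}) : Prop :=
  [/\ is_integral P,
      P <> domset R &
      forall x y, domset R x -> domset R y -> P (x * y) -> P x \/ P y].

Definition span (R : idomainType) (A : set {fraction R}) : set {fraction R} :=
  [set x | exists (n : nat) (r : 'I_n -> R) (a : 'I_n -> {fraction R}),
     (forall i, A (a i)) /\ x = \sum_(i < n) tofrac (r i) * a i].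

Definition is_fg_ideal (R : idomainType) (J : set {fraction R}) : Prop :=
  is_ideal J /\ exists s : seq {fraction R}, J = span [set x | x \in s].

Definition idmul (R : idomainType) (I J : set {fraction R}) :
    set {fraction R} :=
  span [set z | exists x y, [/\ I x, J y & z = x * y]].

Definition idscale (R : idomainType) (a : {fraction R})
    (I : set {fraction R}) : set {fraction R} :=
  [set a * x | x in I].

(* colon J I is (J : I). *)
Definition colon (R : idomainType) (J I : set {fraction R}) :
    set {fraction R} :=
  [set x | idscale x I `<=` J].

(* The localization R_P, as a subset of {fraction R}. *)
Definition locring (R : idomainType) (P : set {fraction R}) :
    set {fraction R} :=
  [set z | exists a s : R,
     ~ P (tofrac s) /\ z = tofrac a / tofrac s].

(* A map on ideals is given as a map on all subsets of {fraction R}, whose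
   values matter only on ideals: every condition below is restricted to
   ideals. *)
Definition is_star (R : idomainType)
    (star : set {fraction R} -> set {fraction R}) : Prop :=
  (forall I, is_ideal I -> is_ideal (star I)) /\
  star (domset R) = domset R /\
  (forall a I, a != 0 -> is_ideal I ->
     star (idscale a I) = idscale a (star I)) /\
  (forall I, is_ideal I -> I `<=` star I) /\
  (forall I J, is_ideal I -> is_ideal J -> I `<=` J -> star I `<=` star J) /\
  (forall I, is_ideal I -> star (star I) = star I).

Definition star_eq (R : idomainType)
    (star1 star2 : set {fraction R} -> set {fraction R}) : Prop :=
  forall I, is_ideal I -> star1 I = star2 I.

Definition ft_part (R : idomainType)
    (star : set {fraction R} -> set {fraction R}) (I : set {fraction R}) :
    set {fraction R} :=
  \bigcup_(J in [set J | is_fg_ideal J /\ J `<=` I]) star J.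

Definition finite_type (R : idomainType)
    (star : set {fraction R} -> set {fraction R}) : Prop :=
  star_eq star (ft_part star).

Definition proper_star_ideal (R : idomainType)
    (star : set {fraction R} -> set {fraction R}) (M : set {fraction R}) :
    Prop :=
  [/\ is_integral M, M <> domset R & star M = M].

Definition starMax (R : idomainType)
    (star : set {fraction R} -> set {fraction R}) : set (set {fraction R}) :=
  [set M | proper_star_ideal star M /\
     forall N, proper_star_ideal star N -> M `<=` N -> N = M].

(* When R is a field, the only ideal is R itself and starMax is empty; the
   empty intersection is then all of {fraction R}, i.e. R, as it should be. *)
Definition tilde (R : idomainType)
    (star : set {fraction R} -> set {fraction R}) (I : set {fraction R}) :
    set {fraction R} :=
  \bigcap_(M in starMax star) idmul I (locring M).

Definition spectral (R : idomainType)
    (star : set {fraction R} -> set {fraction R}) : Prop :=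
  exists G : set (set {fraction R}),
    [/\ forall P, G P -> is_prime P,
        forall P Q, G P -> G Q -> P `<=` Q -> P = Q,
        domset R = \bigcap_(P in G) locring P &
        forall I, is_ideal I ->
          star I = \bigcap_(P in G) idmul I (locring P)].

Definition v_op (R : idomainType) (I : set {fraction R}) : set {fraction R} :=
  colon (domset R) (colon (domset R) I).

Definition t_op (R : idomainType) : set {fraction R} -> set {fraction R} :=
  ft_part (@v_op R).

Definition w_op (R : idomainType) : set {fraction R} -> set {fraction R} :=
  tilde (@t_op R).

Definition clifford_regular (R : idomainType)
    (star : set {fraction R} -> set {fraction R}) : Prop :=
  forall I, is_ideal I ->
    exists J, is_ideal J /\ star I = star (idmul (idmul I I) J).

(* Main.v *)
(** The operation [star] is [I |-> \bigcap_(P in G) I R_P] for a family [G] of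
    primes; the point is that every [P] in [G] is a t-ideal.  Otherwise some
    finitely generated [I] inside [P] has [(R_P : I) = R_P].  Clifford
    regularity gives [I R_P = I (I J R_P)] for some [J], so the determinant
    trick yields [1 \in I J R_P], while [(R_P : I) = R_P] forces
    [I J R_P `<=` R_P], hence [J `<=` R_P] and [1 \in I R_P `<=` P R_P],
    which is absurd.  As [star] lies below t, every t-ideal is a star-ideal;
    since every proper star-ideal is contained in a member of [G], the star-
    and t-maximal ideals coincide, and so do their tilde operations. *)

From mathcomp Require Import all_boot all_order all_algebra.
From mathcomp Require Import boolp classical_sets.
From mathcomp Require Import ring.
Require Import Defs.

Set Implicit Arguments.
Unset Strict Implicit.
Unset Printing Implicit Defensive.

Import GRing.Theory.
Local Open Scope classical_set_scope.
Local Open Scope ring_scope.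

(** * Submodules of the fraction field: spans, products, colons, and the v- and t-closures *)

Section Submodules.
Variable R : idomainType.
Local Notation K := {fraction R}.
Implicit Types (A B C I J W : set K) (x y z : K).

Lemma domset_submod : is_submod (domset R).
Proof.
split.
- by exists 0 => //; rewrite tofrac0.
- by move=> x y [a _ <-] [b _ <-]; exists (a + b) => //; rewrite tofracD.
- by move=> r x [a _ <-]; exists (r * a) => //; rewrite tofracM.
Qed.

Lemma submod_sum W n (f : 'I_n -> K) :
  is_submod W -> (forall i, W (f i)) -> W (\sum_i f i).
Proof.
by case=> W0 WD _ Wf; elim/big_ind: _ => // x y; apply: WD.
Qed.

Lemma submod_opp W x : is_submod W -> W x -> W (- x).
Proof. by case=> _ _ WZ /(WZ (-1)); rewrite tofracN tofrac1 mulN1r. Qed.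

Lemma sub_span A : A `<=` span A.
Proof.
move=> x Ax; exists 1%N, (fun=> 1), (fun=> x); split=> //.
by rewrite big_ord1 tofrac1 mul1r.
Qed.

Lemma span_sub A W : is_submod W -> A `<=` W -> span A `<=` W.
Proof.
move=> Wm AW x [n [r [a [Aa ->]]]]; apply: submod_sum => // i.
by case: Wm => _ _; apply; apply: AW.
Qed.

Lemma span_submod A : is_submod (span A).
Proof.
split.
- by exists 0%N, (fun=> 0), (fun=> 0); split=> [[]|] //; rewrite big_ord0.
- move=> _ _ [n [r [a [Aa ->]]]] [m [q [b [Ab ->]]]].
  exists (n + m)%N, (fun i => match split i with inl j => r j | inr j => q j end),
    (fun i => match split i with inl j => a j | inr j => b j end); split.
    by move=> i; case: split.
  rewrite big_split_ord /=; congr (_ + _); apply: eq_bigr => i _.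
    by rewrite (unsplitK (inl i)).
  by rewrite (unsplitK (inr i)).
- move=> c _ [n [r [a [Aa ->]]]]; exists n, (fun i => c * r i), a; split=> //.
  by rewrite mulr_sumr; apply: eq_bigr => i _; rewrite tofracM mulrA.
Qed.

Lemma colonP J I x : colon J I x <-> forall y, I y -> J (x * y).
Proof.
split=> [h y Iy | h _ [y Iy <-]]; last exact: h.
by apply: h; exists y.
Qed.

Lemma colon_submod W A : is_submod W -> is_submod (colon W A).
Proof.
case=> W0 WD WZ; split.
- by apply/colonP => y _; rewrite mul0r.
- move=> x y /colonP hx /colonP hy; apply/colonP => z Az.
  by rewrite mulrDl; apply: WD; [apply: hx | apply: hy].
- by move=> r x /colonP hx; apply/colonP => z Az; rewrite -mulrA; apply/WZ/hx.
Qed.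

Lemma idmul_submod A B : is_submod (idmul A B).
Proof. exact: span_submod. Qed.

Lemma idmul_mem A B x y : A x -> B y -> idmul A B (x * y).
Proof. by move=> Ax By; apply: sub_span; exists x, y. Qed.

(** Only products of generators need testing. When [W] is itself a colon the lemma applies again, so
    nested products are peeled off one factor at a time. *)
Lemma idmul_sub A B W :
  is_submod W -> A `<=` colon W B -> idmul A B `<=` W.
Proof.
move=> Wm AW; apply: span_sub => // _ [x [y [Ax By ->]]].
by have /colonP := AW _ Ax; apply.
Qed.

Lemma integral_fg_ideal I (s : seq K) x :
  is_integral I -> (forall y, y \in s -> I y) -> x \in s -> x != 0 ->
  is_fg_ideal (span [set y | y \in s]) /\ span [set y | y \in s] `<=` I.
Proof.
move=> [[Im _ _] IR] sI xs x0.
have sub : span [set y | y \in s] `<=` I by apply: span_sub.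
do 2?split => //; last by exists s.
split; first exact: span_submod.
  by exists x; split=> //; apply: sub_span.
exists 1; split=> [|y /sub /IR]; first exact: oner_neq0.
by rewrite tofrac1 mul1r.
Qed.

Lemma idmul_ideal I J : is_ideal I -> is_ideal J -> is_ideal (idmul I J).
Proof.
move=> [Im [x [Ix x0]] [d [d0 hd]]] [Jm [y [Jy y0]] [e [e0 he]]]; split.
- exact: idmul_submod.
- by exists (x * y); rewrite mulf_neq0 //; split=> //; apply: idmul_mem.
- exists (d * e); split=> [|z]; first by rewrite mulf_neq0.
  (* A colon by a singleton expresses the denominator condition as membership in a submodule, so
     that [idmul_sub] applies. *)
  suff : idmul I J `<=` colon (domset R) [set tofrac (d * e)].
    by move=> /[apply] /colonP/(_ _ erefl); rewrite mulrC.
  apply: idmul_sub; first exact/colon_submod/domset_submod.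
  move=> u Iu; apply/colonP => v Jv; apply/colonP => _ ->.
  have [[a _ ea] [b _ eb]] := (hd _ Iu, he _ Jv).
  by exists (a * b) => //; rewrite !tofracM ea eb; ring.
Qed.

Lemma integral_eq_domset I : is_integral I -> I 1 -> I = domset R.
Proof.
move=> [[[_ _ IZ] _ _] IR] I1; apply/seteqP; split=> // _ [r _ <-].
by rewrite -[tofrac r]mulr1; apply: IZ.
Qed.

Lemma domset1 : domset R 1.
Proof. by exists 1 => //; rewrite tofrac1. Qed.

Lemma sub_v_op I : I `<=` v_op I.
Proof.
by move=> x Ix; apply/colonP => y /colonP/(_ _ Ix); rewrite mulrC.
Qed.

Lemma v_op_integral I : I `<=` domset R -> v_op I `<=` domset R.
Proof.
move=> IR x /colonP/(_ 1); rewrite mulr1; apply.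
by apply/colonP => y /IR; rewrite mul1r.
Qed.

Lemma sub_t_op I : is_integral I -> I `<=` t_op I.
Proof.
move=> Ii x Ix; have [[_ [y [Iy y0]] _] _] := Ii.
(* The nonzero [y] keeps the span a nonzero ideal even when [x = 0]. *)
exists (span [set z | z \in [:: x; y]]); last first.
  by apply/sub_v_op/sub_span; rewrite /= inE eqxx.
apply: (integral_fg_ideal (x := y)) => //; last by rewrite !inE eqxx orbT.
by move=> z; rewrite !inE => /orP[] /eqP->.
Qed.

End Submodules.

(** * The determinant trick over a subring without unit *)

Section DeterminantTrick.
Variables (F : fieldType) (L : set F).
Hypotheses (L0 : L 0) (LD : forall x y, L x -> L y -> L (x + y))
  (LN : forall x, L x -> L (- x)) (LM : forall x y, L x -> L y -> L (x * y)).

(** Congruence modulo [L], where [L] need not contain 1. The second clause lets [y] act on [L],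
    which makes the relation compatible with products. *)
Let congL x y := L (x - y) /\ forall l, L l -> L (y * l).

Lemma congL_sum (T : finType) (f g : T -> F) :
  (forall i, congL (f i) (g i)) -> congL (\sum_i f i) (\sum_i g i).
Proof.
move=> fg; apply: (big_ind2 congL) => //.
  by split=> [|l _]; rewrite ?subrr ?mul0r.
move=> x1 x2 y1 y2 [h1 k1] [h2 k2]; split=> [|l Ll].
  by rewrite opprD addrACA; apply: LD.
by rewrite mulrDl; apply: LD; [apply: k1 | apply: k2].
Qed.

Lemma congL_mul x1 x2 y1 y2 :
  congL x1 x2 -> congL y1 y2 -> congL (x1 * y1) (x2 * y2).
Proof.
move=> [h1 k1] [h2 k2]; split=> [|l Ll]; last by rewrite -mulrA; apply/k1/k2.
have -> : x1 * y1 - x2 * y2 =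
  (x1 - x2) * (y1 - y2) + y2 * (x1 - x2) + x2 * (y1 - y2) by ring.
by apply: LD; [apply: LD; [apply: LM | apply: k2] | apply: k1].
Qed.

Lemma congL_bool (b : bool) : congL b%:R b%:R.
Proof. by split=> [|l]; rewrite ?subrr //; case: b; rewrite ?mul1r ?mul0r. Qed.

Lemma congL_sign n : congL ((-1) ^+ n) ((-1) ^+ n).
Proof.
split=> [|l Ll]; rewrite ?subrr // -signr_odd.
by case: odd; rewrite ?mul1r // mulN1r; apply: LN.
Qed.

Lemma congL_det n (A B : 'M[F]_n) :
  (forall i j, congL (A i j) (B i j)) -> congL (\det A) (\det B).
Proof.
move=> AB; apply: congL_sum => s; apply: congL_mul; first exact: congL_sign.
apply: (big_ind2 congL) => //; first exact: (congL_bool true).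
by move=> *; apply: congL_mul.
Qed.

(** The nonzero [v] kills [1 - A], so its determinant is 0; but [1 - A] is the identity modulo [L],
    so that determinant is also congruent to 1. *)
Lemma determinant_trick n (A : 'M[F]_n) (v : 'rV[F]_n) :
  (forall i j, L (A i j)) -> v != 0 -> v *m A = v -> L 1.
Proof.
move=> LA v0 vA.
have dA : \det (1%:M - A) = 0.
  by apply/eqP/det0P; exists v; rewrite // mulmxBr mulmx1 vA subrr.
have : congL (\det (1%:M - A)) (\det (1%:M : 'M[F]_n)).
  apply: congL_det => i j; rewrite !mxE; split; last by case: (congL_bool (i == j)).
  by rewrite addrAC subrr add0r; apply: LN.
by rewrite dA det1 => -[]; rewrite sub0r => /LN; rewrite opprK.
Qed.

End DeterminantTrick.

(** * Localization at a prime, and finitely generated ideals inside it *)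

Section Localization.
Variables (R : idomainType) (P : set {fraction R}).
Hypothesis prP : is_prime P.
Local Notation K := {fraction R}.
Local Notation S := (locring P).

Lemma prime0 : P 0.
Proof. by case: prP => -[[[]]]. Qed.

Lemma prime1 : ~ P 1.
Proof. by case: prP => Pi PR _ P1; apply/PR/integral_eq_domset. Qed.

Lemma prime_mul (s t : R) :
  ~ P (tofrac s) -> ~ P (tofrac t) -> ~ P (tofrac (s * t)).
Proof.
case: prP => _ _ h Ps Pt; rewrite tofracM => /h.
by case=> //; [exists s | exists t].
Qed.

Lemma notin_prime_neq0 (s : R) : ~ P (tofrac s) -> tofrac s != 0 :> K.
Proof. by move=> Ps; apply: contra_notN Ps => /eqP->; apply: prime0. Qed.

Lemma domset_locring : domset R `<=` S.
Proof.
by move=> _ [a _ <-]; exists a, 1; rewrite tofrac1 divr1; split; first exact: prime1.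
Qed.

Lemma locringM x y : S x -> S y -> S (x * y).
Proof.
move=> [a [s [Ps ->]]] [b [t [Pt ->]]]; exists (a * b), (s * t).
by split; [apply: prime_mul | rewrite !tofracM mulf_div].
Qed.

Lemma locring_submod : is_submod S.
Proof.
split.
- by apply/domset_locring; case: (domset_submod R).
- move=> _ _ [a [s [Ps ->]]] [b [t [Pt ->]]]; exists (a * t + b * s), (s * t).
  split; first exact: prime_mul.
  by rewrite tofracD !tofracM addf_div // notin_prime_neq0.
- by move=> r x Sx; apply: locringM => //; apply: domset_locring; exists r.
Qed.

Lemma idmul_locring_closed A x c :
  idmul A S x -> S c -> idmul A S (x * c).
Proof.
move=> Ax Sc; suff : idmul A S `<=` colon (idmul A S) S.
  by move=> /(_ _ Ax)/colonP; apply.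
apply: idmul_sub; first exact/colon_submod/idmul_submod.
move=> a Aa; apply/colonP => d Sd; apply/colonP => e Se.
by rewrite -mulrA; apply: idmul_mem => //; apply: locringM.
Qed.

Lemma sub_idmul_locring A : A `<=` idmul A S.
Proof.
by move=> x Ax; rewrite -[x]mulr1; apply: idmul_mem => //; apply/domset_locring/domset1.
Qed.

Lemma prime_locring1 : ~ idmul P S 1.
Proof.
(* [W] contains P R_P, and [1] in [W] would put some [s] outside [P] into [P]. *)
pose W := [set z : K | exists s : R, ~ P (tofrac s) /\ P (tofrac s * z)].
have [[[[_ PD PZ] _ _] PR] _ _] := prP.
have Wm : is_submod W.
  split.
  - by exists 1; rewrite tofrac1 mulr0; split; [apply: prime1 | apply: prime0].
  - move=> x y [s [Ps Px]] [t [Pt Py]]; exists (s * t).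
    split; first exact: prime_mul.
    have -> : tofrac (s * t) * (x + y) =
      tofrac t * (tofrac s * x) + tofrac s * (tofrac t * y).
      by rewrite tofracM; ring.
    by apply: PD; apply: PZ.
  - move=> r x [s [Ps Px]]; exists s; split=> //.
    by rewrite mulrCA; apply: PZ.
suff sub : idmul P S `<=` W.
  by move=> /sub [s [Ps]]; rewrite mulr1.
apply: idmul_sub => // x Px; apply/colonP => _ [a [s [Ps ->]]].
exists s; split=> //.
have -> : tofrac s * (x * (tofrac a / tofrac s)) = tofrac a * x.
  by rewrite mulrCA [tofrac s * _]mulrC divfK ?notin_prime_neq0 // mulrC.
exact: PZ.
Qed.

Lemma common_denominator (s : seq K) :
  (forall x, x \in s -> S x) ->
  exists u : R, ~ P (tofrac u) /\ forall x, x \in s -> domset R (tofrac u * x).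
Proof.
elim: s => [|x s IHs] sS.
  by exists 1; split=> //; rewrite tofrac1; apply: prime1.
have [u [Pu hu]] := IHs (fun y ys => sS y (mem_behead (s := x :: s) ys)).
have [a [t [Pt ex]]] := sS x (mem_head _ _).
exists (u * t); split; first exact: prime_mul.
move=> y; rewrite inE => /orP[/eqP-> | /hu [b _ eb]].
  exists (u * a) => //; rewrite ex !tofracM.
  by rewrite -mulrA [tofrac t * _]mulrC divfK ?notin_prime_neq0.
by exists (t * b) => //; rewrite !tofracM eb; ring.
Qed.

(* Localization commutes with [(R : I)] because [I] is finitely generated. *)
Lemma colon_locring_v (s : seq K) x y :
  v_op (span [set z | z \in s]) x -> domset R x -> ~ P x ->
  (forall z, z \in s -> S (y * z)) -> S y.
Proof.
move=> /colonP vx [r _ ex] Px Sy.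
have [u [Pu hu]] : exists u : R, ~ P (tofrac u) /\
    forall z, z \in [seq y * z | z <- s] -> domset R (tofrac u * z).
  by apply: common_denominator => _ /mapP[z zs ->]; apply: Sy.
(* Since [u * y] maps the ideal into R, [x * (u * y)] lies in R; thus [y] is a fraction with
   denominator [x * u], outside [P]. *)
have [|a _ ea] := vx (tofrac u * y).
  suff : span [set z | z \in s] `<=` colon (domset R) [set tofrac u * y].
    move=> sub; apply/colonP => z /sub/colonP/(_ _ erefl).
    by rewrite mulrC.
  apply: span_sub; first exact/colon_submod/domset_submod.
  move=> z zs; apply/colonP => _ ->.
  by rewrite mulrC -mulrA; apply/hu/map_f.
exists a, (r * u); rewrite -ex in Px; split; first exact: prime_mul.
rewrite ea -ex tofracM mulrA mulrC mulKf // -tofracM.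
exact/notin_prime_neq0/prime_mul.
Qed.

(** The two inclusions amount to I R_P = I^2 J R_P. An [x] in [v_op I] outside [P] would force (R_P
    : I) into R_P, which is [S_colon] below. *)
Lemma stable_fg_v_sub (s : seq K) (J : set K) :
  let I := span [set x | x \in s] in
  let B := idmul (idmul I I) J in
  is_ideal I -> I `<=` P -> I `<=` idmul B S -> B `<=` idmul I S ->
  v_op I `<=` P.
Proof.
move=> I B [Im [z0 [Iz0 z00]] _] IP IB BI x vx; apply: contrapT => Px.
have [[[Pm _ _] PR] _ _] := prP.
have Rx : domset R x by apply: v_op_integral vx => z /IP /PR.
have S_colon y : (forall i, I i -> S (y * i)) -> S y.
  move=> h; apply: (colon_locring_v vx) => // z zs.
  by apply/h/sub_span.
(* I J R_P is the coefficient ring for the determinant trick. *)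
pose L := idmul (idmul I J) S.
have Lm : is_submod L by exact: idmul_submod.
have IS_S : idmul I S `<=` S.
  apply: idmul_sub; first exact: locring_submod.
  move=> i /IP/PR Ri; apply/colonP => c Sc.
  by apply: locringM => //; apply: domset_locring.
have LI : L `<=` colon (idmul I S) I.
  have ISm := idmul_submod I S.
  apply: idmul_sub; first exact: colon_submod.
  apply: idmul_sub; first by do 2!apply: colon_submod.
  move=> i Ii; apply/colonP => j Jj; apply/colonP => c Sc; apply/colonP => k Ik.
  have -> : i * j * c * k = (i * k * j) * c by ring.
  by apply: idmul_locring_closed => //; apply: BI; do 2!apply: idmul_mem => //.
(* By [LI], [k * i] falls back into I R_P, and the remaining factor [j * c] returns it to [L]. *)
have LL l m : L l -> L m -> L (l * m).
  move=> Ll Lmm; suff : L `<=` colon L L by move=> /(_ _ Ll)/colonP; apply.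
  apply: idmul_sub; first exact: colon_submod.
  apply: idmul_sub; first by do 2!apply: colon_submod.
  move=> i Ii; apply/colonP => j Jj; apply/colonP => c Sc.
  apply/colonP => k Lk.
  have -> : i * j * c * k = k * i * (j * c) by ring.
  suff : idmul I S `<=` colon L [set j * c].
    have /LI/colonP/(_ _ Ii) IS := Lk.
    by move=> /(_ _ IS)/colonP; apply.
  apply: idmul_sub; first exact: colon_submod.
  move=> a Ia; apply/colonP => d Sd; apply/colonP => _ ->.
  have -> : a * d * (j * c) = a * j * (d * c) by ring.
  by do !apply: idmul_mem => //; apply: locringM.
pose a (k : 'I_(size s)) := s`_k.
(* [W] is the set of [L]-combinations of the generators of [I]. It contains I^2 J R_P: one factor
   from [I] is expanded in generators, the rest goes into the coefficient. *)
pose W := [set z : K | exists l : 'I_(size s) -> K,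
  (forall k, L (l k)) /\ z = \sum_k l k * a k].
have Wm : is_submod W.
  case: Lm => L0 LD LZ; split.
  - by exists (fun=> 0); split=> //; rewrite big1 // => k _; rewrite mul0r.
  - move=> _ _ [l [Ll ->]] [m [Lm ->]]; exists (fun k => l k + m k).
    split=> [k|]; first exact: LD.
    by rewrite -big_split; apply: eq_bigr => k _; rewrite mulrDl.
  - move=> r _ [l [Ll ->]]; exists (fun k => tofrac r * l k).
    split=> [k|]; first exact: LZ.
    by rewrite mulr_sumr; apply: eq_bigr => k _; rewrite mulrA.
have BW : idmul B S `<=` W.
  apply: idmul_sub => //; apply: idmul_sub; first exact: colon_submod.
  apply: idmul_sub; first by do 2!apply: colon_submod.
  apply: span_sub; first by do 3!apply: colon_submod.
  move=> i si; apply/colonP => k Ik; apply/colonP => j Jj; apply/colonP => c Sc.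
  have si' : (index i s < size s)%N by rewrite index_mem.
  exists (fun m => if m == Ordinal si' then k * j * c else 0); split.
    move=> m; case: ifP => _; last by case: Lm.
    by do !apply: idmul_mem.
  rewrite (bigD1 (Ordinal si')) //= eqxx big1 ?addr0.
    by rewrite /a nth_index //; ring.
  by move=> m /negPf->; rewrite mul0r.
have aW k : W (a k) by apply/BW/IB/sub_span/mem_nth.
have [l hl] := choice aW.
have L1 : L 1.
  have [L0 LD _] := Lm.
  apply: (@determinant_trick _ L L0 LD _ LL _ (\matrix_(i, k) l k i) (\row_k a k)).
  - by move=> y; apply: submod_opp.
  - by move=> i k; rewrite mxE; case: (hl k).
  (* If all generators vanished, [I] would be zero. *)
  - apply: contra_neq z00 => a0.
    suff : I `<=` [set 0] by apply.
    apply: span_sub.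
      split=> [//|y z -> -> |r y ->]; by rewrite /= ?addr0 ?mulr0.
    move=> y ys; have ys' : (index y s < size s)%N by rewrite index_mem.
    move/rowP/(_ (Ordinal ys')): a0.
    by rewrite !mxE /a /= nth_index.
  - apply/rowP => k; rewrite !mxE; have [_ ->] := hl k.
    by apply: eq_bigr => i _; rewrite !mxE mulrC.
have LS : L `<=` S.
  by move=> y /LI/colonP hy; apply: S_colon => i /hy /IS_S.
(* For [j] in [J], [j I] lies in [L], hence in R_P, so [S_colon] applies once more. *)
have JS : J `<=` S.
  move=> j Jj; apply: S_colon => i Ii; apply/LS/sub_idmul_locring.
  by rewrite mulrC; apply: idmul_mem.
apply: prime_locring1; have : L 1 by []; apply: idmul_sub.
  exact: idmul_submod.
apply: idmul_sub; first exact/colon_submod/idmul_submod.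
move=> i /IP Pi; apply/colonP => j /JS Sj; apply/colonP => c Sc.
by rewrite -mulrA; apply: idmul_mem => //; apply: locringM.
Qed.

End Localization.

(** * Comparison of star-ideals with t-ideals *)

Section StarOperation.
Variables (R : idomainType) (star : set {fraction R} -> set {fraction R}).
Hypothesis hstar : is_star star.

(** For nonzero [y] in (R : I), y I* = (y I)* lies in R* = R. *)
Lemma star_sub_v I : is_ideal I -> star I `<=` v_op I.
Proof.
move=> Ii x sx; have [h1 [h2 [h3 [h4 [h5 h6]]]]] := hstar.
apply/colonP => y /colonP yI.
have [->|y0] := eqVneq y 0; first by rewrite mulr0; case: (domset_submod R).
have yIR : idscale y I `<=` domset R by move=> _ [z Iz <-]; apply: yI.
have yIi : is_ideal (idscale y I).
  have [[I0 ID IZ] [z [Iz z0]] _] := Ii; split.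
  - split; first by exists 0; rewrite ?mulr0.
      by move=> _ _ [u Iu <-] [v Iv <-]; exists (u + v); [apply: ID | rewrite mulrDr].
    by move=> r _ [u Iu <-]; exists (tofrac r * u); [apply: IZ | rewrite mulrCA].
  - by exists (y * z); rewrite mulf_neq0 //; split=> //; exists z.
  - by exists 1; rewrite oner_neq0; split=> // u /yIR; rewrite tofrac1 mul1r.
have Ri : is_ideal (domset R).
  split; first exact: domset_submod.
    by exists 1; rewrite oner_neq0; split=> //; apply: domset1.
  by exists 1; rewrite oner_neq0; split=> // u; rewrite tofrac1 mul1r.
have := h5 _ _ yIi Ri yIR; rewrite h2 h3 //; apply.
by exists x => //; rewrite mulrC.
Qed.

Hypothesis hft : finite_type star.

(** By finite type I* is a union of J* with [J] finitely generated inside [I], and each J* lies in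
    J^v, hence in I^t. *)
Lemma t_ideal_star_ideal I : is_ideal I -> t_op I = I -> star I = I.
Proof.
move=> Ii tI; apply/seteqP; split; last by case: hstar => _ [_ [_ [+ _]]]; apply.
move=> x; rewrite hft // => -[J [[Ji s] JI] sx]; rewrite -tI.
by exists J => //; apply: star_sub_v.
Qed.

Lemma proper_t_star_ideal I :
  proper_star_ideal (@t_op R) I -> proper_star_ideal star I.
Proof. by case=> -[Ii IR] nI tI; split=> //; apply: t_ideal_star_ideal. Qed.

Variable G : set (set {fraction R}).
Hypotheses (prG : forall P, G P -> is_prime P)
  (starG : forall I, is_ideal I -> star I = \bigcap_(P in G) idmul I (locring P)).

Lemma clifford_prime_t P :
  clifford_regular star -> G P -> proper_star_ideal (@t_op R) P.
Proof.
move=> hreg GP; have prP := prG GP; have [Pi PR _] := prP.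
split=> //; apply/seteqP; split; last exact: sub_t_op.
move=> x [I [[Ii [s eI]] IP] vx].
have [J [Ji eIJ]] := hreg _ Ii.
have sub_star A : is_ideal A -> A `<=` star A by case: hstar => _ [_ [_ [+ _]]]; apply.
have Bi : is_ideal (idmul (idmul I I) J) by do !apply: idmul_ideal.
(* Each side of I* = (I^2 J)* is an intersection over [G]; only the component at [P] is kept. *)
have IB : I `<=` idmul (idmul (idmul I I) J) (locring P).
  by move=> y /(sub_star _ Ii); rewrite eIJ starG //; apply.
have BI : idmul (idmul I I) J `<=` idmul I (locring P).
  by move=> y /(sub_star _ Bi); rewrite -eIJ starG //; apply.
by subst I; apply: (stable_fg_v_sub prP Ii IP IB BI).
Qed.

(** If [N] meets the complement of every [P] in [G], then 1 lies in every N R_P, hence in N* = N. *)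
Lemma proper_star_ideal_sub N :
  proper_star_ideal star N -> exists2 P, G P & N `<=` P.
Proof.
move=> [Ni NR sN]; apply: contrapT => noP; apply: NR.
apply: integral_eq_domset => //; rewrite -sN starG; last by case: Ni.
move=> P GP; apply: contrapT => N1; apply: noP; exists P => // x Nx.
have [_ /(_ _ Nx) [r _ er]] := Ni; apply: contrapT => Px; apply: N1.
rewrite -er in Px Nx.
rewrite -(divff (notin_prime_neq0 (prG GP) Px)); apply: idmul_mem => //.
by exists 1, r; rewrite tofrac1 div1r.
Qed.

(** A star-maximal ideal lies in some [P] of [G], a t-ideal and so a proper star-ideal, hence equals
    it. Conversely, a proper star-ideal [N] above a t-maximal [M] lies in some [P] of [G], and
    t-maximality gives [P = M]. *)
Lemma starMax_t : clifford_regular star -> starMax star = starMax (@t_op R).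
Proof.
move=> hreg; apply/seteqP; split=> M [pM maxM].
  have [P GP MP] := proper_star_ideal_sub pM.
  have tP := clifford_prime_t hreg GP.
  have eP := maxM _ (proper_t_star_ideal tP) MP.
  rewrite eP in tP; split=> // N pN.
  exact/maxM/proper_t_star_ideal.
split=> [|N pN MN]; first exact: proper_t_star_ideal.
have [P GP NP] := proper_star_ideal_sub pN.
have eP := maxM _ (clifford_prime_t hreg GP) (subset_trans MN NP).
by apply/seteqP; split=> //; rewrite -eP.
Qed.

End StarOperation.

Theorem corollary1p7 (R : idomainType)
    (star : set {fraction R} -> set {fraction R})
    (hstar : is_star star)
    (hspec : spectral star)
    (hft : finite_type star)
    (htilde : star_eq star (tilde star))
    (hreg : clifford_regular star) :
  star_eq star (@w_op R).
Proof.
have [G [prG _ _ starG]] := hspec.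
move=> I Ii; rewrite htilde // /w_op /tilde.
by rewrite (starMax_t hstar hft prG starG hreg).
Qed.
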